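(* Let $s\in\{0,\tfrac12\}$ and let $S(s)$ be the centerless super-Virasoro algebra over $\mathbb{C}$. Then every super-biderivation $\phi$ of $S(s)$ is an inner super-biderivation; that is, there exists $\lambda\in\mathbb{C}$ such that $\phi(x,y)=\lambda[x,y]$ for all $x,y\in S(s)$.
   Context: All vector spaces are over $\mathbb{C}$. For $s\in\{0,\tfrac12\}$, the centerless super-Virasoro algebra $S(s)=S_{\bar0}(s)\oplus S_{\bar1}(s)$ is the Lie superalgebra whose even part has basis $\{L_m : m\in\mathbb{Z}\}$ and whose odd part has basis $\{G_k : k\in s+\mathbb{Z}\}$, with brackets $[L_m,L_n]=(n-m)L_{m+n}$, $[L_m,G_k]=(k-\tfrac m2)G_{m+k}$, $[G_k,G_l]=2L_{k+l}$ for all $m,n\in\mathbb{Z}$, $k,l\in s+\mathbb{Z}$ (the remaining brackets being determined by skew-supersymmetry $[x,y]=-(-1)^{|x||y|}[y,x]$). Here $|x|\in\mathbb{Z}_2$ is the degree of a homogeneous element $x$. Let $L=L_{\bar0}\oplus L_{\bar1}$ be a Lie superalgebra. A bilinear map $\phi:L\times L\to L$ is homogeneous of degree $|\phi|=\gamma\in\mathbb{Z}_2$ if $\phi(L_\alpha,L_\beta)\subseteq L_{\alpha+\beta+\gamma}$ for all $\alpha,\beta\in\mathbb{Z}_2$. A homogeneous bilinear map $\phi$ is a super-biderivation of $L$ if for all homogeneous $x,y,z\in L$: (i) $\phi(x,y)=-(-1)^{|x||y|}\phi(y,x)$; (ii) $\phi([x,y],z)=(-1)^{|\phi||x|}[x,\phi(y,z)]+(-1)^{|y||z|}[\phi(x,z),y]$;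 (iii) $\phi(x,[y,z])=[\phi(x,y),z]+(-1)^{(|\phi|+|x|)|y|}[y,\phi(x,z)]$. The space of all super-biderivations is $\mathrm{BDer}(L)=\mathrm{BDer}_{\bar0}(L)\oplus\mathrm{BDer}_{\bar1}(L)$, where $\mathrm{BDer}_\gamma(L)$ is the set of homogeneous super-biderivations of degree $\gamma$; so a general super-biderivation is a sum of an even one and an odd one. For $\lambda\in\mathbb{C}$, the map $(x,y)\mapsto\lambda[x,y]$ is called an inner super-biderivation. *)

(* Defs.v *)
From HB Require Import structures.
From mathcomp Require Import all_boot all_order all_algebra finmap ring.
From mathcomp.multinomials Require Import monalg.

Set Implicit Arguments.
Unset Strict Implicit.
Unset Printing Implicit Defensive.

Import GRing.Theory Num.Theory.

Local Open Scope ring_scope.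

(* The group Z_2 of degrees is [bool] with addition [(+)]; the product of two
   degrees is [&&], so the sign (-1)^{|x||y|} is [(-1) ^+ (a && b)]. *)
HB.mixin Record Lmodule_isLieSuperalgebra (F : fieldType) L
    & GRing.Lmodule F L := {
  homog : bool -> {pred L};
  homog_submod_closed : forall a, submod_closed (homog a);
  homog_decomp : forall x : L, exists x0 x1 : L,
    [/\ x0 \in homog false, x1 \in homog true & x = x0 + x1];
  homog_trivI : forall x : L, x \in homog false -> x \in homog true -> x = 0;
  bracket : L -> L -> L;
  bracket_linear_l : forall (c : F) (x y z : L),
    bracket (c *: x + y) z = c *: bracket x z + bracket y z;
  bracket_linear_r : forall (c : F) (x y z : L),
    bracket x (c *: y + z) = c *: bracket x y + bracket x z;
  bracket_homog : forall a b (x y : L), x \in homog a -> y \in homog b ->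
    bracket x y \in homog (a (+) b);
  bracket_skew : forall a b (x y : L), x \in homog a -> y \in homog b ->
    bracket x y = - ((-1) ^+ (a && b) *: bracket y x);
  bracket_jacobi : forall a b c (x y z : L),
    x \in homog a -> y \in homog b -> z \in homog c ->
    bracket x (bracket y z) =
      bracket (bracket x y) z + (-1) ^+ (a && b) *: bracket y (bracket x z)
}.

#[short(type="lieSuperalgType")]
HB.structure Definition LieSuperalgebra (F : fieldType) :=
  { L of Lmodule_isLieSuperalgebra F L & GRing.Lmodule F L }.

Section SuperBiderivations.
Variables (F : fieldType) (L : lieSuperalgType F).

Definition homogeneous_map (g : bool) (phi : L -> L -> L) : Prop :=
  forall a b (x y : L), x \in homog a -> y \in homog b ->
    phi x y \in homog (a (+) b (+) g).

Record homog_super_biderivation (g : bool) (phi : {bilinear L -> L -> L})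
    : Prop := HomogSuperBiderivation {
  sbider_homog : homogeneous_map g phi;
  sbider_skew : forall a b (x y : L), x \in homog a -> y \in homog b ->
    phi x y = - ((-1) ^+ (a && b) *: phi y x);
  sbider_l : forall a b c (x y z : L),
    x \in homog a -> y \in homog b -> z \in homog c ->
    phi (bracket x y) z =
      (-1) ^+ (g && a) *: bracket x (phi y z)
      + (-1) ^+ (b && c) *: bracket (phi x z) y;
  sbider_r : forall a b c (x y z : L),
    x \in homog a -> y \in homog b -> z \in homog c ->
    phi x (bracket y z) =
      bracket (phi x y) z
      + (-1) ^+ ((g (+) a) && b) *: bracket y (phi x z)
}.

Definition super_biderivation (phi : {bilinear L -> L -> L}) : Prop :=
  exists phi0 phi1 : {bilinear L -> L -> L},
    [/\ homog_super_biderivation false phi0,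
        homog_super_biderivation true phi1 &
        forall x y, phi x y = phi0 x y + phi1 x y].

Definition inner_super_biderivation (phi : {bilinear L -> L -> L}) : Prop :=
  exists lambda : F, forall x y, phi x y = lambda *: bracket x y.

End SuperBiderivations.

Notation svir_index := (int + int)%type.

(* The parameter [h : bool] stands for s = h/2.  The space has basis
   [svir_index]: [inl m] is L_m, and [inr j] is G_{s+j}. *)
Definition superVirasoro (F : numFieldType) (h : bool) : Type :=
  {malg F[svir_index]}.

HB.instance Definition _ (F : numFieldType) (h : bool) :=
  GRing.Lmodule.copy (superVirasoro F h) {malg F[svir_index]}.

Section SuperVirasoro.
Variables (F : numFieldType) (h : bool).
Local Notation S := (superVirasoro F h).

Definition svir_s : F := h%:R / 2.

Definition svir_L (m : int) : S := << (inl m : svir_index) >>.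

(* [svir_G j] is G_k for k = s + j. *)
Definition svir_G (j : int) : S := << (inr j : svir_index) >>.

Definition svir_basis_bracket (u v : svir_index) : S :=
  match u, v with
  | inl m, inl n => (n - m)%:~R *: svir_L (m + n)
  | inl m, inr j => ((svir_s + j%:~R) - m%:~R / 2) *: svir_G (m + j)
  | inr j, inl m => - (((svir_s + j%:~R) - m%:~R / 2) *: svir_G (m + j))
  | inr i, inr j => 2 *: svir_L (h%:Z + i + j) (* 2s + i + j = k + l *)
  end.

Definition svir_extend (f : svir_index -> S) (x : S) : S :=
  \sum_(u <- msupp x) x@_u *: f u.

Definition svir_bracket (x y : S) : S :=
  svir_extend (fun u => svir_extend (svir_basis_bracket u) y) x.

Definition svir_deg (u : svir_index) : bool :=
  if u is inr _ then true else false.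

Definition svir_homog (a : bool) : {pred S} :=
  fun x => all (fun u => svir_deg u == a) (msupp x).

Lemma svir_extendEw f (x : S) (d : {fset svir_index}) :
  (msupp x `<=` d)%fset -> svir_extend f x = \sum_(u <- d) x@_u *: f u.
Proof.
move=> le; rewrite /svir_extend; apply: big_fset_incl => // u _ nu.
by rewrite (mcoeff_outdom nu) scale0r.
Qed.

Lemma svir_extend_linear f : linear (svir_extend f).
Proof.
move=> c x y; pose d := (msupp x `|` msupp y)%fset.
have sx : (msupp x `<=` d)%fset by apply: fsubsetUl.
have sy : (msupp y `<=` d)%fset by apply: fsubsetUr.
have sxy : (msupp (c *: x + y) `<=` d)%fset.
  apply: (fsubset_trans (msuppD_le _ _)); apply: fsetSU; exact: msuppZ_le.
rewrite (svir_extendEw f sx) (svir_extendEw f sy) (svir_extendEw f sxy).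
rewrite scaler_sumr -big_split; apply: eq_bigr => u _ /=.
by rewrite mcoeffD mcoeffZ scalerDl scalerA.
Qed.

Lemma svir_extendU f u : svir_extend f (<< u >> : {malg F[svir_index]}) = f u.
Proof. by rewrite /svir_extend msuppU oner_eq0 big_seq_fset1 mcoeffUU scale1r. Qed.

Lemma svir_bracket_linear_l c (x y z : S) :
  svir_bracket (c *: x + y) z = c *: svir_bracket x z + svir_bracket y z.
Proof. exact: svir_extend_linear. Qed.

Lemma svir_bracket_linear_r c (x y z : S) :
  svir_bracket x (c *: y + z) = c *: svir_bracket x y + svir_bracket x z.
Proof.
rewrite /svir_bracket {1}/svir_extend.
under eq_bigr do rewrite svir_extend_linear scalerDr scalerA [_ * c]mulrC -scalerA.
by rewrite big_split -scaler_sumr.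
Qed.

Lemma svir_bracketU u v :
  svir_bracket (<< u >> : {malg F[svir_index]}) (<< v >> : {malg F[svir_index]})
  = svir_basis_bracket u v.
Proof. by rewrite /svir_bracket !svir_extendU. Qed.

Lemma svir_bracket_LL m n :
  svir_bracket (svir_L m) (svir_L n) = (n - m)%:~R *: svir_L (m + n).
Proof. exact: svir_bracketU. Qed.

Lemma svir_bracket_LG m j :
  svir_bracket (svir_L m) (svir_G j) =
  ((svir_s + j%:~R) - m%:~R / 2) *: svir_G (m + j).
Proof. exact: svir_bracketU. Qed.

Lemma svir_bracket_GL j m :
  svir_bracket (svir_G j) (svir_L m) =
  - (((svir_s + j%:~R) - m%:~R / 2) *: svir_G (m + j)).
Proof. exact: svir_bracketU. Qed.

Lemma svir_bracket_GG i j :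
  svir_bracket (svir_G i) (svir_G j) = 2 *: svir_L (h%:Z + i + j).
Proof. exact: svir_bracketU. Qed.

Local Opaque svir_bracket svir_extend.

Lemma svir_homogP a (x : S) :
  reflect (forall u, x@_u != 0 -> svir_deg u = a) (x \in svir_homog a).
Proof.
apply: (iffP allP) => hx u.
  by rewrite mcoeff_neq0 => /hx /eqP.
by rewrite -mcoeff_neq0 => /hx ->.
Qed.

Local Opaque svir_homog.

Lemma svir_homog_submod_closed a : submod_closed (svir_homog a).
Proof.
split=> [|c x y hx hy].
  by apply/svir_homogP => u; rewrite mcoeff0 eqxx.
apply/svir_homogP => u; rewrite mcoeffD mcoeffZ => nz.
have [xu|] := eqVneq x@_u 0; last by move/svir_homogP: hx; apply.
by move/svir_homogP: hy; apply; move: nz; rewrite xu mulr0 add0r.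
Qed.

Lemma svir_homogU a u : svir_deg u = a ->
  (<< u >> : {malg F[svir_index]}) \in svir_homog a.
Proof.
move=> <-; apply/svir_homogP => v; rewrite mcoeffU.
by case: (u =P v) => [->|] //; rewrite eqxx.
Qed.

Lemma svir_malgUE (c : F) (u : svir_index) :
  << c *g u >> = c *: (<< u >> : {malg F[svir_index]}).
Proof. by apply/malgP => v; rewrite mcoeffZ !mcoeffU mulrnAr mulr1. Qed.

Lemma svir_homog_ind a (P : S -> Prop) :
  P 0 ->
  (forall c u x, svir_deg u = a -> P x ->
     P (c *: (<< u >> : {malg F[svir_index]}) + x)) ->
  forall x, x \in svir_homog a -> P x.
Proof.
move=> P0 PS x /allP hx; rewrite (monalgE x).
have : {subset (msupp x : seq _) <= msupp x} by [].
elim: {1 2}(msupp x : seq _) => [|u r IH] sub; first by rewrite big_nil.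
rewrite big_cons svir_malgUE; apply: PS.
  by apply/eqP/hx/sub; rewrite inE eqxx.
by apply: IH => v vr; apply: sub; rewrite inE vr orbT.
Qed.

Lemma svir_homog_decomp (x : S) : exists x0 x1 : S,
  [/\ x0 \in svir_homog false, x1 \in svir_homog true & x = x0 + x1].
Proof.
pose p a : S := \sum_(u <- msupp x | svir_deg u == a)
  x@_u *: (<< u >> : {malg F[svir_index]}).
have hp a : p a \in svir_homog a.
  apply: (@big_ind _ (fun z : S => z \in svir_homog a)).
  - by case: (svir_homog_submod_closed a).
  - move=> y z hy hz; case: (svir_homog_submod_closed a) => _ /(_ 1 _ _ hy hz).
    by rewrite scale1r.
  - move=> u /eqP du; case: (svir_homog_submod_closed a) => h0.
    by move/(_ x@_u _ _ (svir_homogU du) h0); rewrite addr0.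
exists (p false), (p true); split=> //.
rewrite {1}(monalgE x) (bigID (fun u => svir_deg u == false)) /=.
congr (_ + _).
  by rewrite /p; apply: eq_bigr => u _; rewrite svir_malgUE.
by rewrite /p; apply: eq_big => [u|u _]; [case: (svir_deg u)|rewrite svir_malgUE].
Qed.

Lemma svir_homog_trivI (x : S) :
  x \in svir_homog false -> x \in svir_homog true -> x = 0.
Proof.
move=> /svir_homogP h0 /svir_homogP h1; apply/malgP => u; rewrite mcoeff0.
by apply/eqP/negPn/negP => nz; move: (h0 u nz); rewrite (h1 u nz).
Qed.

Lemma svir_bracket0l (x : S) : svir_bracket 0 x = 0.
Proof.
by have := svir_bracket_linear_l (-1) 0 0 x; rewrite scaler0 addr0 scaleN1r addNr.
Qed.

Lemma svir_bracket0r (x : S) : svir_bracket x 0 = 0.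
Proof.
by have := svir_bracket_linear_r (-1) x 0 0; rewrite scaler0 addr0 scaleN1r addNr.
Qed.

Lemma svir_bracketZl c (x y : S) :
  svir_bracket (c *: x) y = c *: svir_bracket x y.
Proof.
by have := svir_bracket_linear_l c x 0 y; rewrite svir_bracket0l !addr0.
Qed.

Lemma svir_bracketZr c (x y : S) :
  svir_bracket x (c *: y) = c *: svir_bracket x y.
Proof.
by have := svir_bracket_linear_r c x y 0; rewrite svir_bracket0r !addr0.
Qed.

Lemma svir_bracket_homog a b (x y : S) :
  x \in svir_homog a -> y \in svir_homog b ->
  svir_bracket x y \in svir_homog (a (+) b).
Proof.
have [h0 hS] := svir_homog_submod_closed (a (+) b).
move=> hx; move: x hx y; apply: svir_homog_ind => [|c u x du IH] y hy.
  by rewrite svir_bracket0l.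
rewrite svir_bracket_linear_l; apply: (hS); last exact: IH.
move: y hy; apply: svir_homog_ind => [|d v y dv IHy].
  by rewrite svir_bracket0r.
rewrite svir_bracket_linear_r; apply: (hS); last exact: IHy.
rewrite svir_bracketU.
have hZ e (z : S) : z \in svir_homog (a (+) b) ->
    e *: z \in svir_homog (a (+) b).
  by move=> hz; rewrite -[e *: z]addr0; apply: (hS).
by clear IH IHy; case: u v du dv => [m|i] [n|j] du dv; subst a b;
  cbn [svir_basis_bracket]; rewrite -?scaleNr; apply: (hZ); exact: svir_homogU.
Qed.

Lemma svir_bracket_skew a b (x y : S) :
  x \in svir_homog a -> y \in svir_homog b ->
  svir_bracket x y = - ((-1) ^+ (a && b) *: svir_bracket y x).
Proof.
have comb (e k : F) (p q p' q' : S) :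
    p = - (e *: q) -> p' = - (e *: q') -> k *: p + p' = - (e *: (k *: q + q')).
  by move=> -> ->; rewrite scalerDr opprD scalerN !scalerA [e * k]mulrC.
move=> hx; move: x hx y; apply: svir_homog_ind => [|c u x du IH] y hy.
  by rewrite svir_bracket0l svir_bracket0r scaler0 oppr0.
rewrite svir_bracket_linear_l svir_bracket_linear_r.
apply: (comb); last exact: IH.
move: y hy; apply: svir_homog_ind => [|d v y dv IHy].
  by rewrite svir_bracket0l svir_bracket0r scaler0 oppr0.
rewrite svir_bracket_linear_l svir_bracket_linear_r.
apply: (comb); last exact: IHy.
rewrite !svir_bracketU -{}du -{}dv; clear IH IHy.
case: u v => [m|i] [n|j] /=; rewrite ?expr0 ?expr1 ?scale1r ?opprK //.
- by rewrite [n + m]addrC -scaleNr -opprB rmorphN.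
- by rewrite scaleN1r opprK addrAC.
Qed.

Lemma svir_jacobi_aux (V : lmodType F) (br : V -> V -> V) (l g : int -> V)
  (brZl : forall c x y, br (c *: x) y = c *: br x y)
  (brZr : forall c x y, br x (c *: y) = c *: br x y)
  (brLL : forall m n, br (l m) (l n) = (n - m)%:~R *: l (m + n))
  (brLG : forall m j,
     br (l m) (g j) = ((svir_s + j%:~R) - m%:~R / 2) *: g (m + j))
  (brGL : forall j m,
     br (g j) (l m) = - (((svir_s + j%:~R) - m%:~R / 2) *: g (m + j)))
  (brGG : forall i j, br (g i) (g j) = 2 *: l (h%:Z + i + j)) :
  let U u := match u with inl m => l m | inr j => g j end in
  forall u v w, br (U u) (br (U v) (U w)) =
    br (br (U u) (U v)) (U w)
    + (-1) ^+ (svir_deg u && svir_deg v) *: br (U v) (br (U u) (U w)).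
Proof.
have two : (2 : F) != 0 by rewrite pnatr_eq0.
have brE := (brLL, brLG, brGL, brGG).
move=> U [m|i] [n|j] [p|k]; rewrite /U; cbn [svir_deg andb];
  rewrite ?expr0 ?expr1 !brE -?scaleNr ?brZl ?brZr !brE -?scaleNr ?scalerN;
  rewrite -?scaleNr !scalerA.
- have -> : m + (n + p) = m + n + p by ring.
  have -> : n + (m + p) = m + n + p by ring.
  by rewrite -scalerDl; congr (_ *: _); ring.
- have -> : m + (n + k) = m + n + k by ring.
  have -> : n + (m + k) = m + n + k by ring.
  by rewrite -scalerDl; congr (_ *: _); field.
- have -> : p + (m + j) = m + (p + j) by ring.
  have -> : m + p + j = m + (p + j) by ring.
  by rewrite -scalerDl; congr (_ *: _); field.
- have -> : m + (h%:Z + j + k) = h%:Z + j + (m + k) by ring.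
  have -> : h%:Z + (m + j) + k = h%:Z + j + (m + k) by ring.
  by rewrite -scalerDl; congr (_ *: _); rewrite /svir_s; field.
- have -> : n + p + i = p + (n + i) by ring.
  have -> : n + (p + i) = p + (n + i) by ring.
  by rewrite -scalerDl; congr (_ *: _); field.
- have -> : h%:Z + (n + i) + k = n + (h%:Z + i + k) by ring.
  have -> : h%:Z + i + (n + k) = n + (h%:Z + i + k) by ring.
  by rewrite -scalerDl; congr (_ *: _); rewrite /svir_s; field.
- have -> : h%:Z + i + (p + j) = h%:Z + i + j + p by ring.
  have -> : h%:Z + j + (p + i) = h%:Z + i + j + p by ring.
  by rewrite -scalerDl; congr (_ *: _); rewrite /svir_s; field.
- have -> : h%:Z + j + k + i = h%:Z + i + j + k by ring.
  have -> : h%:Z + i + k + j = h%:Z + i + j + k by ring.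
  by rewrite -scalerDl; congr (_ *: _); rewrite /svir_s; field.
Qed.

Lemma svir_jacobiU u v w :
  let U k : S := (<< k >> : {malg F[svir_index]}) in
  svir_bracket (U u) (svir_bracket (U v) (U w)) =
    svir_bracket (svir_bracket (U u) (U v)) (U w)
    + (-1) ^+ (svir_deg u && svir_deg v)
        *: svir_bracket (U v) (svir_bracket (U u) (U w)).
Proof.
have := svir_jacobi_aux svir_bracketZl svir_bracketZr svir_bracket_LL
  svir_bracket_LG svir_bracket_GL svir_bracket_GG u v w.
by case: u v w => [m|i] [n|j] [p|k]; exact.
Qed.

Lemma svir_bracket_jacobi a b c (x y z : S) :
  x \in svir_homog a -> y \in svir_homog b -> z \in svir_homog c ->
  svir_bracket x (svir_bracket y z) =
    svir_bracket (svir_bracket x y) z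
    + (-1) ^+ (a && b) *: svir_bracket y (svir_bracket x z).
Proof.
have comb (e k : F) (p q r p' q' r' : S) :
    p = q + e *: r -> p' = q' + e *: r' ->
    k *: p + p' = k *: q + q' + e *: (k *: r + r').
  move=> -> ->; rewrite !scalerDr !scalerA [e * k]mulrC -!addrA.
  by congr (_ + _); rewrite addrCA.
move=> hx; move: x hx y z; apply: svir_homog_ind => [|e u x du IH] y z hy hz.
  by rewrite !(svir_bracket0l, svir_bracket0r) scaler0 addr0.
rewrite !(svir_bracket_linear_l, svir_bracket_linear_r).
apply: (comb); last exact: IH.
move: y hy z hz; apply: svir_homog_ind => [|f v y dv IHy] z hz.
  by rewrite !(svir_bracket0l, svir_bracket0r) scaler0 addr0.
rewrite !(svir_bracket_linear_l, svir_bracket_linear_r).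
apply: (comb); last exact: IHy.
move: z hz; apply: svir_homog_ind => [|g w z dw IHz].
  by rewrite !(svir_bracket0l, svir_bracket0r) scaler0 addr0.
rewrite !(svir_bracket_linear_l, svir_bracket_linear_r).
apply: (comb); last exact: IHz.
by rewrite -{}du -{}dv; exact: svir_jacobiU.
Qed.

HB.instance Definition _ := Lmodule_isLieSuperalgebra.Build F S
  svir_homog_submod_closed svir_homog_decomp svir_homog_trivI
  svir_bracket_linear_l svir_bracket_linear_r
  svir_bracket_homog svir_bracket_skew svir_bracket_jacobi.

End SuperVirasoro.

(* Main.v *)
(* [ad L_0] is diagonal in the basis L_m, G_k, with eigenvalues (weights) m, k.
   For a homogeneous super-biderivation phi put D = phi(L_0, -).  Skewness gives
   D(L_0) = 0, so D preserves weights and each D(L_m), D(G_k) is a multiple of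
   one basis vector.  Expanding phi(x, z) by the rules (ii) and (iii) along L_0 and
   comparing the coefficients of weight wt x + wt z yields two linear equations
   for one unknown, and these force D = lambda ad L_0, with lambda = 0 when phi
   is odd.  Then psi = phi - lambda [-, -] kills L_0, so psi(x, z) = 0 unless
   x and z have the same weight; the remaining values vanish because L_n and G_k
   are multiples of brackets [L_i, z'] with wt z' different from wt x. *)

Require Import Defs.
From mathcomp Require Import all_boot all_order all_algebra reals complex.
From mathcomp Require Import finmap ring zify.
From mathcomp.multinomials Require Import monalg.

Set Implicit Arguments.
Unset Strict Implicit.
Unset Printing Implicit Defensive.

Import GRing.Theory Num.Theory.

Local Open Scope ring_scope.

Section SuperVirasoroBiderivations.
Variables (F : numFieldType) (h : bool).
Local Notation S := (superVirasoro F h).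
Local Notation U u := (<< u >> : S).
Local Notation Lv := (@svir_L F h).
Local Notation Gv := (@svir_G F h).
Local Notation br := (@svir_bracket F h).

(** * Weights, the diagonal action of [ad L_0], and a vanishing criterion *)

Definition svir_weight (u : svir_index) : F :=
  match u with inl m => m%:~R | inr j => svir_s F h + j%:~R end.
Local Notation wt := svir_weight.

(** For s = 0 the vectors L_m and G_m share the weight m; only the degree tells them apart. *)
Lemma svir_weight_deg_inj u v :
  wt u = wt v -> svir_deg u = svir_deg v -> u = v.
Proof.
by case: u v => [m|i] [n|j] //= => [|/addrI] /intr_inj ->.
Qed.

Lemma half_int_neq0 (a : int) : (2 * a + 1)%:~R / 2 != 0 :> F.
Proof. by rewrite mulf_neq0 ?invr_eq0 ?pnatr_eq0 // intr_eq0; lia. Qed.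

Lemma svir_basis_homog u : U u \in @svir_homog F h (svir_deg u).
Proof. exact: svir_homogU. Qed.

Lemma svir_bracket_L0_basis u : br (Lv 0) (U u) = wt u *: U u.
Proof.
rewrite svir_bracketU; case: u => [m|j] /=.
  by rewrite subr0 add0r.
by rewrite mul0r subr0 add0r.
Qed.

Lemma svir_expand (x : S) : x = \sum_(u <- msupp x) x@_u *: U u.
Proof. by rewrite {1}(monalgE x); apply: eq_bigr => u _; rewrite svir_malgUE. Qed.

Lemma svir_bracket_L0_coeff (x : S) v : (br (Lv 0) x)@_v = wt v * x@_v.
Proof.
rewrite [in RHS](svir_expand x) /svir_bracket svir_extendU /svir_extend.
rewrite !raddf_sum mulr_sumr; apply: eq_bigr => u _.
have -> : svir_basis_bracket F h (inl 0) u = wt u *: U u.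
  by rewrite -svir_bracket_L0_basis svir_bracketU.
rewrite /= !mcoeffZ mcoeffU.
by case: (u =P v) => [->|_]; rewrite ?mulr1n ?mulr0n; ring.
Qed.

Lemma svir_bracket_expand (x y : S) :
  br x y = \sum_(u <- msupp x) x@_u *:
    \sum_(v <- msupp y) y@_v *: br (U u) (U v).
Proof.
rewrite [in LHS]/svir_bracket /svir_extend; apply: eq_bigr => u _.
by congr (_ *: _); apply: eq_bigr => v _; rewrite svir_bracketU.
Qed.

Lemma svir_bracketBl c (x y z : S) :
  br (x - c *: y) z = br x z - c *: br y z.
Proof. by rewrite addrC -scaleNr svir_bracket_linear_l scaleNr addrC. Qed.

Lemma svir_bracketBr c (x y z : S) :
  br z (x - c *: y) = br z x - c *: br z y.
Proof. by rewrite addrC -scaleNr svir_bracket_linear_r scaleNr addrC. Qed.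

Lemma svir_eqN0 (x : S) : x = - x -> x = 0.
Proof.
have two : 2%:R != 0 :> F by rewrite pnatr_eq0.
move/eqP; rewrite -addr_eq0 -mulr2n -scaler_nat scaler_eq0 (negPf two) orFb.
by move/eqP.
Qed.

Local Opaque svir_bracket svir_extend.

Lemma svir_weight_coeff (x y : S) (c : F) t :
  c *: x = br (Lv 0) x + y -> (c - wt t) * x@_t = y@_t.
Proof.
move/(congr1 (mcoeff t)); rewrite mcoeffZ mcoeffD svir_bracket_L0_coeff.
by rewrite mulrBl => ->; rewrite addrC addKr.
Qed.

Lemma svir_coeffZ (x : S) c t : (c *: x)@_t = c * x@_t.
Proof. exact: mcoeffZ. Qed.

Lemma svir_coeffN (x : S) t : (- x)@_t = - x@_t.
Proof. exact: mcoeffN. Qed.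

Lemma svir_bracket_skewU u v :
  (-1) ^+ (svir_deg u && svir_deg v) *: br (U v) (U u) = - br (U u) (U v).
Proof.
apply: oppr_inj; rewrite opprK; apply: esym.
exact: svir_bracket_skew (svir_basis_homog u) (svir_basis_homog v).
Qed.

Lemma svir_bracket_skewL u n : br (Lv n) (U u) = - br (U u) (Lv n).
Proof. by have := svir_bracket_skewU u (inl n); rewrite andbF expr0 scale1r. Qed.

Lemma svir_two_weights0 (x : S) (c d : F) :
  c != d -> br (Lv 0) x = c *: x -> br (Lv 0) x = d *: x -> x = 0.
Proof.
move=> ne -> /eqP; rewrite -subr_eq0 -scalerBl scaler_eq0 subr_eq0 (negPf ne).
by move/eqP.
Qed.

(** The first three hypotheses put [psi (U u) (U v)] in the eigenspace of [ad L_0] for [wt v], the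
    fourth in that for [wt u]. Taking a bare function [psi] lets the lemma apply directly to phi -
    lambda [-, -]. *)
Lemma svir_vanish (psi : S -> S -> S) :
  (forall u c v, psi (U u) (c *: U v) = c *: psi (U u) (U v)) ->
  (forall u n v, psi (U u) (br (Lv n) (U v)) =
     br (psi (U u) (Lv n)) (U v) + br (Lv n) (psi (U u) (U v))) ->
  (forall u, psi (U u) (Lv 0) = 0) ->
  (forall u v, br (Lv 0) (psi (U u) (U v)) = wt u *: psi (U u) (U v)) ->
  forall u v, psi (U u) (U v) = 0.
Proof.
move=> psiZ psi_r psi0 wl.
have ne0 u v : wt u != wt v -> psi (U u) (U v) = 0.
  move=> ne; apply: (svir_two_weights0 ne) => //.
  by rewrite -psiZ -svir_bracket_L0_basis psi_r psi0 svir_bracket0l add0r.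
have psiL u n : psi (U u) (Lv n) = 0.
  have [wu|] := eqVneq (wt u) (n%:~R); last exact: (ne0 u (inl n)).
  have [->|n0] := eqVneq n 0; first exact: psi0.
  (* [L_{-n}, L_{2n}] = 3n L_n, and both -n and 2n differ from n once n is nonzero. *)
  have : psi (U u) (br (Lv (- n)) (Lv (2 * n))) = 0.
    rewrite (psi_r u (- n) (inl (2 * n))) (ne0 u (inl (- n))) ?(ne0 u (inl _)).
    - by rewrite svir_bracket0l svir_bracket0r addr0.
    - by rewrite wu /= eqr_int; lia.
    - by rewrite wu /= eqr_int; lia.
  rewrite svir_bracket_LL psiZ => /eqP; rewrite scaler_eq0 intr_eq0.
  have -> : - n + 2 * n = n by ring.
  by case/orP=> /eqP //; lia.
move=> u [n|j]; first exact: psiL.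
have [wu|] := eqVneq (wt u) (wt (inr j)); last exact: ne0.
(* With i = 1 + h, the structure constant of [L_i, G_k] is k - i/2, and its
   numerator 2k - i is odd for every k in s + Z, hence nonzero. *)
have : psi (U u) (br (Lv (1 + h%:Z)) (Gv (j - (1 + h%:Z)))) = 0.
  rewrite (psi_r u _ (inr _)) psiL ne0 ?svir_bracket0l ?svir_bracket0r ?addr0 //.
  by rewrite wu /= (inj_eq (addrI _)) eqr_int; lia.
rewrite svir_bracket_LG psiZ => /eqP; rewrite scaler_eq0.
have -> : svir_s F h + (j - (1 + h%:Z))%:~R - (1 + h%:Z)%:~R / 2 =
    (2 * (j - 2 - h%:Z) + 1)%:~R / 2.
  by rewrite /svir_s !(intrD, intrM, rmorphN) /=; field.
rewrite (negPf (half_int_neq0 _)) => /eqP.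
by have -> : 1 + h%:Z + (j - (1 + h%:Z)) = j by ring.
Qed.

(** * Weight identities for a homogeneous super-biderivation *)

Section Homogeneous.
Variables (g : bool) (phi : {bilinear S -> S -> S}).
Hypothesis phiB : homog_super_biderivation g phi.

Lemma sbider_deg u v t :
  (phi (U u) (U v))@_t != 0 -> svir_deg t = svir_deg u (+) svir_deg v (+) g.
Proof.
have := sbider_homog phiB (svir_basis_homog u) (svir_basis_homog v).
by move/svir_homogP; apply.
Qed.

Lemma sbider_L_r u n z :
  phi (U u) (br (Lv n) (U z)) =
  br (phi (U u) (Lv n)) (U z) + br (Lv n) (phi (U u) (U z)).
Proof.
have := sbider_r phiB (svir_basis_homog u) (svir_basis_homog (inl n))
  (svir_basis_homog z).
by rewrite andbF expr0 scale1r.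
Qed.

Lemma sbider_L0_r u : phi (U u) (Lv 0) = - phi (Lv 0) (U u).
Proof.
have := sbider_skew phiB (svir_basis_homog u) (svir_basis_homog (inl 0)).
by rewrite andbF expr0 scale1r.
Qed.

Lemma sbider_L0L0 : phi (Lv 0) (Lv 0) = 0.
Proof. by apply: svir_eqN0; exact: (sbider_L0_r (inl 0)). Qed.

(** Rule (ii) on [L_0, U u]; since L_0 is even, the sign involving |phi| disappears. Rule (iii) on
    [L_0, U v] gives the companion [sbider_weight_r]. *)
Lemma sbider_weight_l u v :
  wt u *: phi (U u) (U v) =
  br (Lv 0) (phi (U u) (U v))
  + (-1) ^+ (svir_deg u && svir_deg v) *: br (phi (Lv 0) (U v)) (U u).
Proof.
have := sbider_l phiB (svir_basis_homog (inl 0)) (svir_basis_homog u)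
  (svir_basis_homog v).
rewrite andbF expr0 scale1r => <-.
by rewrite -linearZl_LR /= -svir_bracket_L0_basis.
Qed.

Lemma sbider_weight_r u v :
  wt v *: phi (U u) (U v) =
  br (Lv 0) (phi (U u) (U v)) - br (phi (Lv 0) (U u)) (U v).
Proof.
rewrite -linearZr_LR /= -svir_bracket_L0_basis sbider_L_r sbider_L0_r.
by rewrite -scaleN1r svir_bracketZl scaleN1r addrC.
Qed.

Lemma sbider_L0_weight u v : wt u != wt v -> (phi (Lv 0) (U u))@_v = 0.
Proof.
move=> ne; have := sbider_weight_r (inl 0) u.
rewrite [phi (U _) (U _)]/(phi (Lv 0) _) sbider_L0L0 svir_bracket0l oppr0.
move/(@svir_weight_coeff _ _ _ v)/eqP; rewrite mcoeff0 mulf_eq0 subr_eq0.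
by rewrite (negPf ne) => /eqP.
Qed.

(** Weight and degree together single out one basis vector. It need not be [U u]: for odd phi and s
    = 0, L_n is paired with G_n. *)
Lemma sbider_L0_single u v :
  wt v = wt u -> svir_deg v = svir_deg u (+) g ->
  phi (Lv 0) (U u) = (phi (Lv 0) (U u))@_v *: U v.
Proof.
move=> wv dv; apply/malgP => t; rewrite mcoeffZ mcoeffU.
case: (v =P t) => [->|ne]; first by rewrite mulr1.
rewrite mulr0; apply/eqP/negPn/negP => nz; apply: ne.
apply: svir_weight_deg_inj; last by rewrite dv (sbider_deg (u := inl 0) nz).
apply/eqP; rewrite wv; apply: contraR nz => /sbider_L0_weight ->.
by rewrite eqxx.
Qed.

(** The difference phi - lambda [-, -] obeys the same rules and kills L_0, so [svir_vanish] applies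
    on basis vectors; bilinearity does the rest. *)
Lemma sbider_inner_of_L0 lambda :
  (forall u, phi (Lv 0) (U u) = lambda *: br (Lv 0) (U u)) ->
  forall x y, phi x y = lambda *: br x y.
Proof.
move=> D.
suff basis u v : phi (U u) (U v) - lambda *: br (U u) (U v) = 0.
  move=> x y; rewrite [in LHS](svir_expand x) [in LHS](svir_expand y).
  rewrite linear_sumlz svir_bracket_expand scaler_sumr.
  apply: eq_bigr => u _; rewrite linearZl_LR linear_sumr /=.
  rewrite [RHS]scalerA mulrC -scalerA; congr (_ *: _).
  rewrite scaler_sumr; apply: eq_bigr => v _.
  rewrite linearZr_LR /= [RHS]scalerA mulrC -scalerA.
  by congr (_ *: _); apply/eqP; rewrite -subr_eq0 basis.
apply: (svir_vanish (psi := fun x y => phi x y - lambda *: br x y)) => {u v}.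
- move=> u c v; rewrite linearZr_LR /= svir_bracketZr scalerBr !scalerA.
  by rewrite [lambda * c]mulrC.
- move=> u n v; rewrite sbider_L_r.
  have := svir_bracket_jacobi (svir_basis_homog u) (svir_basis_homog (inl n))
    (svir_basis_homog v).
  rewrite andbF expr0 scale1r => ->.
  by rewrite svir_bracketBl svir_bracketBr scalerDr opprD addrACA.
- move=> u; rewrite sbider_L0_r D.
  by rewrite svir_bracket_skewL scalerN opprK addrN.
- move=> u v; rewrite svir_bracketBr scalerBr sbider_weight_l D.
  rewrite (svir_bracket_L0_basis v) !svir_bracketZl.
  have jac : br (Lv 0) (br (U u) (U v)) = (wt u + wt v) *: br (U u) (U v).
    have := svir_bracket_jacobi (svir_basis_homog (inl 0)) (svir_basis_homog u)
      (svir_basis_homog v).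
    rewrite expr0 scale1r (svir_bracket_L0_basis u) (svir_bracket_L0_basis v).
    by rewrite svir_bracketZl svir_bracketZr -scalerDl.
  rewrite jac; have := svir_bracket_skewU u v.
  (* Skewness reads e C = -B, so both sides equal A - lambda (p + q) B. *)
  move: (br (U v) (U u)) (br (U u) (U v)) (br (Lv 0) _) => C B A.
  move: (wt u) (wt v) (_ ^+ _) => p q e sk.
  rewrite !scalerA [e * _]mulrC -[X in A + X - _]scalerA sk scalerN -addrA.
  by rewrite -opprD -scalerDl; congr (A - _ *: B); ring.
Qed.

(** At weight [wt u + wt v] the factor [wt u - wt t] is [- wt v]; [sbider_coeff_r] is the second
    equation for the same unknown coefficient. *)
Lemma sbider_coeff_l u v t : wt t = wt u + wt v ->
  wt v * (phi (U u) (U v))@_t =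
  - ((-1) ^+ (svir_deg u && svir_deg v) * (br (phi (Lv 0) (U v)) (U u))@_t).
Proof.
move=> wE; have /(@svir_weight_coeff _ _ _ t) := sbider_weight_l u v.
by rewrite wE svir_coeffZ => <-; ring.
Qed.

Lemma sbider_coeff_r u v t : wt t = wt u + wt v ->
  wt u * (phi (U u) (U v))@_t = (br (phi (Lv 0) (U u)) (U v))@_t.
Proof.
move=> wE; have /(@svir_weight_coeff _ _ _ t) := sbider_weight_r u v.
by rewrite wE svir_coeffN => E; apply: oppr_inj; rewrite -E; ring.
Qed.

(** * The map phi(L_0, -) in the even and odd cases *)

Lemma sbider_even_L0 : g = false ->
  exists lambda, forall u, phi (Lv 0) (U u) = lambda *: br (Lv 0) (U u).
Proof.
move=> g0; pose a u := (phi (Lv 0) (U u))@_u.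
have Da u : phi (Lv 0) (U u) = a u *: U u.
  by apply: sbider_L0_single; rewrite // g0 addbF.
(* With x and c the coefficients at t of phi(L_m, U v) and [L_m, U v], the two equations are m x =
   a(L_m) c and wt(v) x = a(v) c; eliminate x and cancel c. *)
have aE m v t : wt t = wt (inl m) + wt v -> (br (Lv m) (U v))@_t != 0 ->
    m%:~R * a v = wt v * a (inl m).
  move=> wE ne0; apply: (mulIf ne0).
  have eqr := sbider_coeff_r wE; have eql := sbider_coeff_l wE.
  rewrite Da svir_bracketZl mcoeffZ in eqr.
  rewrite Da /= expr0 mul1r svir_bracketZl mcoeffZ in eql.
  have sk := svir_bracket_skew (svir_basis_homog (inl m)) (svir_basis_homog v).
  rewrite -mulrN -mcoeffN in eql.
  rewrite /= expr0 scale1r in sk; rewrite -sk in eql.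
  by rewrite -!mulrA -[LHS]/(wt (inl m) * _) -eql -eqr; ring.
(* L_1 has weight 1, so lambda is its own eigenvalue under phi(L_0, -). *)
exists (a (inl 1)) => u; rewrite Da svir_bracket_L0_basis scalerA; congr (_ *: _).
have aL n : a (inl n) = a (inl 1) * n%:~R.
  have [->|n1] := eqVneq n 1; first by rewrite mulr1.
  rewrite [RHS]mulrC -[LHS]mul1r.
  apply: (aE 1 (inl n) (inl (1 + n))); first by rewrite /= intrD.
  by rewrite svir_bracket_LL mcoeffZ mcoeffUU mulr1 intr_eq0 subr_eq0.
case: u => [n|j]; first exact: aL.
(* G_k is compared with L_{1+h}, because [L_{1+h}, G_k] has coefficient j - 1/2, never zero. *)
have n0 : (1 + h%:Z)%:~R != 0 :> F by rewrite intr_eq0; lia.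
apply: (mulfI n0); rewrite (aE _ _ (inr (1 + h%:Z + j))).
- by rewrite aL; ring.
- by rewrite /= intrD; ring.
rewrite svir_bracket_LG mcoeffZ mcoeffUU mulr1.
have -> : svir_s F h + j%:~R - (1 + h%:Z)%:~R / 2 = (2 * (j - 1) + 1)%:~R / 2.
  by rewrite /svir_s !(intrD, intrM, rmorphN) /=; field.
exact: half_int_neq0.
Qed.

Lemma sbider_odd_L0 u : g = true -> phi (Lv 0) (U u) = 0.
Proof.
(* For s = 1/2 even and odd basis vectors have no common weight, so an odd weight-preserving map is
   zero. *)
move=> g1; have [h1|h0] : h = true \/ h = false by case: (h); [left|right].
  apply/malgP => t; rewrite mcoeff0; apply/eqP/negPn/negP => nz.
  have dt := sbider_deg (u := inl 0) nz.
  have : wt u = wt t.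
    by apply/eqP; apply: contraR nz => /sbider_L0_weight ->; rewrite eqxx.
  have half_ne (m j : int) : m%:~R <> svir_s F h + j%:~R.
    rewrite /svir_s h1 => E.
    have : (2 * (j - m) + 1)%:~R / 2 = 0 :> F.
      by rewrite -(subrr (m%:~R)) {1}E !(intrD, intrM, rmorphN) /=; field.
    by move/eqP; apply/negP/half_int_neq0.
  move: dt; rewrite g1; case: u t {nz} => [m|j] [n|i] //= _; first exact: half_ne.
  by move/esym; exact: half_ne.
have s0 : svir_s F h = 0 by rewrite /svir_s h0 mul0r.
pose a n := (phi (Lv 0) (Lv n))@_(inr n).
pose b n := (phi (Lv 0) (Gv n))@_(inl n).
have DL n : phi (Lv 0) (Lv n) = a n *: Gv n.
  by apply: (@sbider_L0_single (inl n) (inr n)); rewrite ?g1 //= s0 add0r.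
have DG n : phi (Lv 0) (Gv n) = b n *: Lv n.
  by apply: (@sbider_L0_single (inr n) (inl n)); rewrite ?g1 //= s0 add0r.
(* For s = 0 this is the unknown shared by the two equations, which link it to [a n] and to
   [b m]. *)
pose e m n := (phi (Gv m) (Lv n))@_(inl (m + n)).
have wE m n : wt (inl (m + n)) = wt (inr m) + wt (inl n).
  by rewrite /= s0 add0r intrD.
have el m n : n%:~R * e m n = - (2 * a n).
  rewrite -[n%:~R]/(wt (inl n)) (sbider_coeff_l (wE m n)) /= DL svir_bracketZl.
  rewrite svir_bracket_GG !mcoeffZ h0 add0r [n + m]addrC mcoeffUU; ring.
have er m n : m%:~R * e m n = b m * (n - m)%:~R.
  have := sbider_coeff_r (wE m n); rewrite /= s0 add0r => ->.
  by rewrite DG svir_bracketZl svir_bracket_LL !mcoeffZ mcoeffUU mulr1.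
(* On the diagonal m = n, [er] has right-hand side 0 since [L_n, L_n] = 0. *)
have a0 n : a n = 0.
  have /eqP := el n n; rewrite er subrr mulr0 eq_sym oppr_eq0 mulf_eq0.
  by rewrite pnatr_eq0 => /eqP.
have b0 m : b m = 0.
  (* n != 0 forces [e m n = 0] through [el]; n != m lets the factor n - m be cancelled in [er]. *)
  have [n n0 nm] : exists2 n : int, n != 0 & n != m.
    by have [->|] := eqVneq m 1; [exists 2 | exists 1; rewrite // eq_sym].
  have /eqP := el m n; rewrite a0 mulr0 oppr0 mulf_eq0 intr_eq0 (negPf n0) => /eqP E.
  have /eqP := er m n; rewrite E mulr0 eq_sym mulf_eq0 intr_eq0 subr_eq0 (negPf nm).
  by rewrite orbF => /eqP.
by case: u => [n|j]; [rewrite [LHS]DL a0 scale0r | rewrite [LHS]DG b0 scale0r].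
Qed.

End Homogeneous.

(** * Assembling the even and odd components *)

Lemma super_biderivation_inner (phi : {bilinear S -> S -> S}) :
  super_biderivation phi -> inner_super_biderivation phi.
Proof.
case=> phi0 [phi1 [B0 B1 E]].
have [lambda D0] := sbider_even_L0 B0 erefl.
exists lambda => x y; rewrite E (sbider_inner_of_L0 B0 D0).
have -> : phi1 x y = 0 *: br x y.
  by apply: (sbider_inner_of_L0 B1) => u; rewrite scale0r (sbider_odd_L0 B1).
by rewrite scale0r addr0.
Qed.

End SuperVirasoroBiderivations.

Theorem theorem4p3 (R : realType) (h : bool)
    (phi : {bilinear superVirasoro R[i] h -> superVirasoro R[i] h
                     -> superVirasoro R[i] h}) :
  super_biderivation phi -> inner_super_biderivation phi.
Proof. exact: super_biderivation_inner. Qed.
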